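(* Let $M\ge1$ be an integer, $L,r,f_B,D,\lambda>0$, $0\le C<ML$, $p_1\ge p_2\ge\dots\ge p_M>0$ with $\sum_{i=1}^M p_i=1$, and $\lambda_i=p_i\lambda$. For each $i$ put $$E(T_i)=\sqrt{\frac{\pi L}{2r\lambda_i}}\,\mathrm{erf}\left(D\sqrt{\frac{r\lambda_i}{2L}}\right)+\frac{L}{Dr\lambda_i}\exp\left(-\frac{D^2r\lambda_i}{2L}\right).$$ Consider the cache allocation problem $$\min_{(l_1,\dots,l_M)}\ \sum_{i=1}^M\frac{L-l_i}{f_B\,E(T_i)}\quad\text{subject to}\quad\sum_{i=1}^M l_i\le C,\qquad 0\le l_i\le L\ \ (i=1,\dots,M).$$ Then the optimal cache allocation is $$l_i=\begin{cases}L,&1\le i\le k-1,\\ C\bmod L,&i=k,\\ 0,&k+1\le i\le M,\end{cases}\qquad\text{where } k=\lfloor C/L\rfloor+1 .$$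
   Context: Notation: $\mathrm{erf}(t)=\frac{2}{\sqrt\pi}\int_0^t e^{-y^2}\,dy$ and $C\bmod L=C-L\lfloor C/L\rfloor$. Interpretation: $M$ videos of equal length $L$ and bitrate $r$, with popularities $p_i$; requests arrive at total rate $\lambda$ and each is for an interval of fixed duration $D$ from a random start point of a (cyclic) video; $E(T_i)$ is the mean time between successive transmissions of a portion of video $i$; $l_i$ is the cache size allocated to video $i$; the $i$-th summand is the average bandwidth consumption of video $i$ with bandwidth efficiency $f_B$. *)

(* Defs.v *)
(* Written over the concrete reals of Stdlib, with Coquelicot's integral and sums.
   Videos are indexed by 1..M, as in the usual notation: a vector indexed by
   videos is a function nat -> R of which only the values at 1..M are used. *)
From Stdlib Require Import Reals ZArith Zfloor.
From Coquelicot Require Import Coquelicot.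
Open Scope R_scope.

Definition erf (t : R) : R :=
  2 / sqrt PI * RInt (fun y => exp (- y ^ 2)) 0 t.

Definition Rmod (x y : R) : R := x - y * IZR (Zfloor (x / y)).

(* Mean time between successive transmissions of a portion of a video requested
   at rate lam. *)
Definition ET (L r D lam : R) : R :=
  sqrt (PI * L / (2 * r * lam)) * erf (D * sqrt (r * lam / (2 * L)))
  + L / (D * r * lam) * exp (- (D ^ 2 * r * lam / (2 * L))).

Definition total_bandwidth (M : nat) (L r fB D lambda : R) (p l : nat -> R) : R :=
  sum_n_m (fun i => (L - l i) / (fB * ET L r D (p i * lambda))) 1 M.

Definition feasible (M : nat) (L C : R) (l : nat -> R) : Prop :=
  sum_n_m l 1 M <= C /\ (forall i : nat, (1 <= i <= M)%nat -> 0 <= l i <= L).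

Definition is_minimizer {A : Type} (P : A -> Prop) (f : A -> R) (x : A) : Prop :=
  P x /\ (forall y : A, P y -> f x <= f y).

Definition popular_first_allocation (L C : R) (i : nat) : R :=
  let k := (Zfloor (C / L) + 1)%Z in
  match (Z.of_nat i ?= k)%Z with
  | Lt => L
  | Eq => Rmod C L
  | Gt => 0
  end.

(* Main.v *)
(** The substitution y = u sqrt(r lam / 2L) turns the mean time between
    transmissions into the integral over [0, D] of exp(-s u^2) plus
    exp(-D^2 s) / (2 D s), where s = r lam / 2L.  Both terms decrease in lam, so the
    bandwidth saved per unit of cache decreases with the rank of the video, and
    moving cache to a more popular video never hurts. *)
Require Import Defs.
From Stdlib Require Import Reals ZArith Zfloor Lia Lra.
From Coquelicot Require Import Coquelicot.
Open Scope R_scope.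

Lemma ex_RInt_gaussian (s a b : R) : ex_RInt (fun u => exp (- (s * u ^ 2))) a b.
Proof.
  apply (ex_RInt_continuous (V := R_CompleteNormedModule)); intros u _.
  apply (ex_derive_continuous (V := R_NormedModule)); auto_derive; exact I.
Qed.

(** In the defining formula [lam] enters a decreasing prefactor and an increasing [erf]; the
    substitution merges them, so that each remaining term is visibly monotone in [s]. *)
Lemma ET_gaussian (L r D lam : R) (HL : 0 < L) (Hr : 0 < r) (HD : 0 < D)
  (Hlam : 0 < lam) (s := r * lam / (2 * L)) :
  ET L r D lam =
  RInt (fun u => exp (- (s * u ^ 2))) 0 D + exp (- (D ^ 2 * s)) / (2 * D * s).
Proof.
  assert (Hs : 0 < s) by (unfold s; apply Rdiv_lt_0_compat; nra).
  assert (Ha : 0 < sqrt s) by now apply sqrt_lt_R0.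
  assert (Haa : sqrt s * sqrt s = s) by (apply sqrt_sqrt; lra).
  assert (HP : 0 < sqrt PI) by (apply sqrt_lt_R0, PI_RGT_0).
  (* The radicand is [PI / (4 * s)]. Times the constant [2 / sqrt PI] of [erf] this leaves
     [1 / sqrt s], which cancels the Jacobian [sqrt s] below. *)
  assert (Hcoef : sqrt (PI * L / (2 * r * lam)) = sqrt PI / 2 / sqrt s).
  { apply Rsqr_inj.
    - apply sqrt_pos.
    - apply Rlt_le; repeat apply Rdiv_lt_0_compat; lra.
    - rewrite Rsqr_sqrt.
      + replace (Rsqr (sqrt PI / 2 / sqrt s))
          with ((sqrt PI * sqrt PI) / 4 / (sqrt s * sqrt s))
          by (unfold Rsqr; field; lra).
        rewrite Haa, sqrt_sqrt by (apply Rlt_le, PI_RGT_0).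
        unfold s; field; lra.
      + assert (HPI := PI_RGT_0).
        apply Rlt_le, Rdiv_lt_0_compat; nra. }
  assert (Hsubst : RInt (fun y => exp (- y ^ 2)) 0 (D * sqrt s) =
                   sqrt s * RInt (fun u => exp (- (s * u ^ 2))) 0 D).
  { rewrite <- (RInt_scal (V := R_CompleteNormedModule)) by apply ex_RInt_gaussian.
    assert (Hlin := RInt_comp_lin (V := R_CompleteNormedModule)
                      (fun y => exp (- y ^ 2)) (sqrt s) 0 0 D).
    replace (sqrt s * 0 + 0) with 0 in Hlin by ring.
    replace (sqrt s * D + 0) with (D * sqrt s) in Hlin by ring.
    rewrite <- Hlin.
    - apply RInt_ext; intros u _.
      unfold scal; simpl; unfold mult; simpl.
      (* Only the bare [s] becomes [sqrt s * sqrt s]; those under the root stay. *)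
      do 3 f_equal; rewrite <- Haa at 3; ring.
    - apply ex_RInt_ext with (fun y => exp (- (1 * y ^ 2))).
      + intros y _; now rewrite Rmult_1_l.
      + apply ex_RInt_gaussian. }
  unfold ET, erf; fold s.
  rewrite Hcoef, Hsubst.
  replace (D ^ 2 * r * lam / (2 * L)) with (D ^ 2 * s) by (unfold s; field; lra).
  replace (L / (D * r * lam)) with (/ (2 * D * s)) by (unfold s; field; lra).
  field; lra.
Qed.

Lemma ET_pos (L r D lam : R) (HL : 0 < L) (Hr : 0 < r) (HD : 0 < D)
  (Hlam : 0 < lam) : 0 < ET L r D lam.
Proof.
  rewrite ET_gaussian by assumption.
  assert (Hs : 0 < r * lam / (2 * L)) by (apply Rdiv_lt_0_compat; nra).
  apply Rplus_le_lt_0_compat.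
  - apply RInt_ge_0; [lra | apply ex_RInt_gaussian |].
    intros u _; apply Rlt_le, exp_pos.
  - apply Rdiv_lt_0_compat; [apply exp_pos | nra].
Qed.

Lemma ET_decr (L r D lam1 lam2 : R) (HL : 0 < L) (Hr : 0 < r) (HD : 0 < D)
  (Hlam1 : 0 < lam1) (Hlam : lam1 <= lam2) : ET L r D lam2 <= ET L r D lam1.
Proof.
  rewrite !ET_gaussian by lra.
  assert (Hs1 : 0 < r * lam1 / (2 * L)) by (apply Rdiv_lt_0_compat; nra).
  assert (Hs : r * lam1 / (2 * L) <= r * lam2 / (2 * L)).
  { apply Rmult_le_compat_r; [apply Rlt_le, Rinv_0_lt_compat; lra | nra]. }
  set (s1 := r * lam1 / (2 * L)) in *; set (s2 := r * lam2 / (2 * L)) in *.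
  assert (Hexp : forall u, exp (- (s2 * u ^ 2)) <= exp (- (s1 * u ^ 2))).
  { intro u; assert (H := pow2_ge_0 u).
    (* [exp_increasing] is strict, while equality occurs at [u = 0]. *)
    destruct (Rle_lt_or_eq (- (s2 * u ^ 2)) (- (s1 * u ^ 2))) as [Hlt | Heq]; [nra | |].
    - now apply Rlt_le, exp_increasing.
    - rewrite Heq; apply Rle_refl. }
  apply Rplus_le_compat.
  - apply RInt_le; [lra | apply ex_RInt_gaussian | apply ex_RInt_gaussian |].
    intros u _; apply Hexp.
  - apply Rmult_le_compat.
    + apply Rlt_le, exp_pos.
    + apply Rlt_le, Rinv_0_lt_compat; nra.
    + rewrite !(Rmult_comm (D ^ 2)); apply Hexp.
    + apply Rinv_le_contravar; nra.
Qed.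

Lemma Zfloor_div_bound (L C : R) (HL : 0 < L) :
  IZR (Zfloor (C / L)) * L <= C < (IZR (Zfloor (C / L)) + 1) * L.
Proof.
  destruct (Zfloor_bound (C / L)) as [H1 H2].
  assert (HCL : C / L * L = C) by (field; lra).
  split; nra.
Qed.

(* The first i entries hold min(i L, C) in total, so the entries are the successive
   differences of that quantity. *)
Lemma popular_first_allocation_diff (L C : R) (i : nat) (HL : 0 < L) :
  popular_first_allocation L C (S i) = Rmin (INR (S i) * L) C - Rmin (INR i * L) C.
Proof.
  destruct (Zfloor_div_bound L C HL) as [H1 H2].
  unfold popular_first_allocation, Rmod.
  rewrite S_INR, INR_IZR_INZ.
  set (q := Zfloor (C / L)) in *.
  (* Since [q * L <= C < (q + 1) * L], the threshold [C] separates the two minima exactly when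
     [i = q]; before that both are multiples of [L], after it both are [C]. *)
  destruct (Z.compare_spec (Z.of_nat (S i)) (q + 1)) as [E | E | E].
  - replace (Z.of_nat i) with q by lia.
    rewrite Rmin_right, Rmin_left by lra; ring.
  - assert (Hi : IZR (Z.of_nat i) + 1 <= IZR q) by (rewrite <- plus_IZR; apply IZR_le; lia).
    rewrite !Rmin_left by nra; ring.
  - assert (Hi : IZR q + 1 <= IZR (Z.of_nat i)) by (rewrite <- plus_IZR; apply IZR_le; lia).
    rewrite !Rmin_right by nra; ring.
Qed.

(** The differences telescope, starting from [Rmin 0 C = 0]. *)
Lemma sum_popular_first_allocation (L C : R) (n : nat) (HL : 0 < L) (HC : 0 <= C) :
  sum_n_m (popular_first_allocation L C) 1 n = Rmin (INR n * L) C.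
Proof.
  induction n as [| n IH].
  - rewrite sum_n_m_zero by lia; simpl; rewrite Rmult_0_l, Rmin_left by lra; reflexivity.
  - rewrite sum_n_Sm by lia.
    rewrite IH, popular_first_allocation_diff by assumption.
    unfold plus; simpl; ring.
Qed.

Lemma popular_first_allocation_bound (L C : R) (i : nat) (HL : 0 < L) :
  0 <= popular_first_allocation L C i <= L.
Proof.
  destruct (Zfloor_div_bound L C HL) as [H1 H2].
  unfold popular_first_allocation, Rmod.
  destruct (Z.of_nat i ?= Zfloor (C / L) + 1)%Z; lra.
Qed.

Lemma popular_first_allocation_feasible (M : nat) (L C : R) (HL : 0 < L) (HC : 0 <= C) :
  feasible M L C (popular_first_allocation L C).
Proof.
  split.
  - rewrite sum_popular_first_allocation by assumption; apply Rmin_r.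
  - intros i _; now apply popular_first_allocation_bound.
Qed.

(** The pointwise maximum of [a] and [b] dominates [a] at every index, as [sum_n_m_le] requires, and
    agrees with [b] on the range of summation. *)
Lemma sum_n_m_Rle_loc (a b : nat -> R) (m n : nat)
  (Hab : forall i, (m <= i <= n)%nat -> a i <= b i) : sum_n_m a m n <= sum_n_m b m n.
Proof.
  rewrite (sum_n_m_ext_loc b (fun i => Rmax (a i) (b i))).
  - apply sum_n_m_le; intro i; apply Rmax_l.
  - intros i Hi; symmetry; apply Rmax_right, Hab, Hi.
Qed.

(* With k the partially filled video, [(w i - w k) (l i - y i) >= 0] for every i. *)
Lemma popular_first_allocation_maximizes (M : nat) (L C : R) (w y : nat -> R)
  (HL : 0 < L) (HC : 0 <= C < INR M * L)
  (Hw_pos : forall i, (1 <= i <= M)%nat -> 0 <= w i)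
  (Hw_noninc : forall i j, (1 <= i)%nat -> (i <= j)%nat -> (j <= M)%nat -> w j <= w i)
  (Hy : feasible M L C y) :
  sum_n_m (fun i => w i * y i) 1 M <=
  sum_n_m (fun i => w i * popular_first_allocation L C i) 1 M.
Proof.
  destruct Hy as [Hysum Hybound].
  destruct (Zfloor_div_bound L C HL) as [Hq1 Hq2].
  set (q := Zfloor (C / L)) in *.
  (* The bounds [0 <= q < M] place [k = q + 1] among the videos [1..M]. *)
  assert (Hq0 : (0 <= q)%Z).
  { assert (H : (-1 < q)%Z) by (apply lt_IZR; nra). lia. }
  assert (HqM : (q < Z.of_nat M)%Z).
  { apply lt_IZR; rewrite <- INR_IZR_INZ; nra. }
  set (k := Z.to_nat (q + 1)).
  assert (Hk : Z.of_nat k = (q + 1)%Z) by (unfold k; lia).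
  assert (Hk1 : (1 <= k <= M)%nat) by lia.
  set (l := popular_first_allocation L C).
  assert (Hterm : forall i, (1 <= i <= M)%nat ->
            w i * y i + w k * l i <= w i * l i + w k * y i).
  { intros i Hi; specialize (Hybound i Hi).
    unfold l, popular_first_allocation; fold q; rewrite <- Hk.
    (* Before [k], [l i = L >= y i] and [w i >= w k]; after [k], both inequalities are reversed,
       with [l i = 0]. *)
    destruct (Z.compare_spec (Z.of_nat i) (Z.of_nat k)) as [E | E | E].
    - apply Nat2Z.inj in E; rewrite E; lra.
    - assert (w k <= w i) by (apply Hw_noninc; lia); nra.
    - assert (w i <= w k) by (apply Hw_noninc; lia); nra. }
  apply sum_n_m_Rle_loc in Hterm.
  assert (Hplus : forall a b : nat -> R,
            sum_n_m (fun i => a i + b i) 1 M = sum_n_m a 1 M + sum_n_m b 1 M)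
    by (intros a b; apply (sum_n_m_plus (G := R_AbelianMonoid) a b)).
  assert (Hmult : forall a : nat -> R,
            sum_n_m (fun i => w k * a i) 1 M = w k * sum_n_m a 1 M)
    by (intro a; apply (sum_n_m_mult_l (K := R_Ring) (w k) a)).
  rewrite !Hplus, !Hmult in Hterm.
  unfold l in Hterm at 1.
  (* As [C < INR M * L], the entries of [l] sum to exactly [C], while those of [y] sum to at most
     [C]; [w k >= 0] then concludes. *)
  rewrite sum_popular_first_allocation, Rmin_right in Hterm by lra.
  assert (Hwk := Hw_pos k Hk1).
  nra.
Qed.

Theorem lemma4 (M : nat) (L r fB D lambda C : R) (p : nat -> R)
  (HM : (1 <= M)%nat)
  (HL : 0 < L) (Hr : 0 < r) (HfB : 0 < fB) (HD : 0 < D) (Hlambda : 0 < lambda)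
  (HC : 0 <= C < INR M * L)
  (Hp_noninc : forall i j : nat, (1 <= i)%nat -> (i <= j)%nat -> (j <= M)%nat -> p j <= p i)
  (Hp_pos : forall i : nat, (1 <= i <= M)%nat -> 0 < p i)
  (Hp_sum : sum_n_m p 1 M = 1) :
  is_minimizer (feasible M L C) (total_bandwidth M L r fB D lambda p)
    (popular_first_allocation L C).
Proof.
  split; [apply popular_first_allocation_feasible; lra |].
  intros y Hy.
  set (w := fun i => / (fB * ET L r D (p i * lambda))).
  assert (HE : forall i, (1 <= i <= M)%nat -> 0 < fB * ET L r D (p i * lambda)).
  { intros i Hi; specialize (Hp_pos i Hi).
    apply Rmult_lt_0_compat; [assumption | apply ET_pos; nra]. }
  assert (Hmax : sum_n_m (fun i => w i * y i) 1 M <=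
                 sum_n_m (fun i => w i * popular_first_allocation L C i) 1 M).
  { apply popular_first_allocation_maximizes; try assumption.
    - intros i Hi; apply Rlt_le, Rinv_0_lt_compat, HE, Hi.
    - intros i j Hi Hij Hj; apply Rinv_le_contravar; [apply HE; lia |].
      apply Rmult_le_compat_l; [lra |].
      assert (Hpj : 0 < p j) by (apply Hp_pos; lia).
      apply ET_decr; try assumption; [nra |].
      apply Rmult_le_compat_r; [lra | now apply Hp_noninc]. }
  (* Cost plus saving is the same for every allocation, so minimal cost amounts to maximal
     saving. *)
  assert (Hcost : forall l, total_bandwidth M L r fB D lambda p l
                    + sum_n_m (fun i => w i * l i) 1 M = sum_n_m (fun i => w i * L) 1 M).
  { intro l; unfold total_bandwidth.
    etransitivity; [symmetry; apply (sum_n_m_plus (G := R_AbelianMonoid)) |].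
    apply sum_n_m_ext; intro i; unfold plus; simpl; unfold w, Rdiv; ring. }
  assert (H1 := Hcost y); assert (H2 := Hcost (popular_first_allocation L C)).
  lra.
Qed.
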